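(* Let $(X,\mathcal F,\mu)$ be a $\sigma$-finite measure space, let $M_u$ be a positive multiplication operator and $C_\varphi$ a bounded composition operator on $L^2(\mu)$. Then $C_\varphi$ is an $M_u$-isometry if and only if $$u=J=h_\varphi\cdot E(u)\circ\varphi^{-1}\quad\text{a.e.},$$ where $J:=h_\varphi\cdot E(u)\circ\varphi^{-1}$.
   Context: A positive multiplication operator is $M_uf=u\cdot f$ with $u$ essentially bounded, measurable and $u\ge0$ a.e. The map $\varphi:X\to X$ is measurable and non-singular ($\mu\circ\varphi^{-1}\ll\mu$), and $C_\varphi f=f\circ\varphi$. $h_\varphi=\frac{d(\mu\circ\varphi^{-1})}{d\mu}$. $E(f)=E(f\mid\varphi^{-1}(\mathcal F))$ is the conditional expectation with respect to $\varphi^{-1}(\mathcal F)$ and $\mu$ (defined for $f\in L^2(\mu)$ and for nonnegative measurable $f$). $E(f)\circ\varphi^{-1}$ denotes the measurable function $g$, unique a.e. on $\{h_\varphi\ne0\}$ and taken to be $0$ elsewhere, with $g\circ\varphi=E(f)$ a.e. For a positive bounded operator $A$, $\|f\|_A=\langle Af,f\rangle^{1/2}$, and a bounded operator $T$ is an $A$-isometry if $\|Tf\|_A=\|f\|_A$ for all $f$ (equivalently $T^*AT=A$). *)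

(* Defs.v *)
From HB Require Import structures.
From mathcomp Require Import all_boot all_order all_algebra.
From mathcomp Require Import all_classical all_reals all_analysis.
From mathcomp Require Import measurable_realfun complex.

Set Implicit Arguments.
Unset Strict Implicit.
Unset Printing Implicit Defensive.

Import Order.TTheory GRing.Theory Num.Theory.
Import numFieldNormedType.Exports.

Local Open Scope classical_set_scope.
Local Open Scope ring_scope.
Local Open Scope complex_scope.

(* Elements of L^2(mu) are handled through representatives T -> R[i], so
   equality in L^2(mu) is equality mu-a.e. *)
Section L2.
Context d (T : measurableType d) (R : realType).
Variable mu : {measure set T -> \bar R}.
Implicit Types f g : T -> R[i].

Definition L2norm f : \bar R :=
  Lnorm mu 2%:E (fun x => (ComplexField.Normc.normc (f x))%:E).

Definition L2 f : Prop :=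
  [/\ measurable_fun setT (fun x => complex.Re (f x)),
      measurable_fun setT (fun x => complex.Im (f x))
    & (L2norm f < +oo)%E].

Definition cintegral f : R[i] :=
  (\int[mu]_x complex.Re (f x)) +i* (\int[mu]_x complex.Im (f x)).

Definition inner f g : R[i] := cintegral (fun x => f x * (g x)^*).

Definition bounded_operator (S : (T -> R[i]) -> (T -> R[i])) : Prop :=
  [/\ forall f, L2 f -> L2 (S f),
      forall f g, L2 f -> L2 g -> f = g %[ae mu] -> S f = S g %[ae mu],
      forall (a : R[i]) f g, L2 f -> L2 g ->
        S (fun x => a * f x + g x) = (fun x => a * S f x + S g x) %[ae mu]
    & exists M : R, forall f, L2 f -> (L2norm (S f) <= M%:E * L2norm f)%E].

Definition seminorm (A : (T -> R[i]) -> (T -> R[i])) f : R[i] :=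
  sqrtC (inner (A f) f).

Definition A_isometry (A S : (T -> R[i]) -> (T -> R[i])) : Prop :=
  forall f, L2 f -> seminorm A (S f) = seminorm A f.

End L2.

Section operators.
Context d (T : measurableType d) (R : realType).

Definition mul_op (u : T -> R) (f : T -> R[i]) : T -> R[i] :=
  fun x => (u x)%:C * f x.

Definition comp_op (phi : T -> T) (f : T -> R[i]) : T -> R[i] := f \o phi.

Definition positive_multiplier (mu : {measure set T -> \bar R}) (u : T -> R) :
  Prop := u \in Lfun mu +oo%E /\ \forall x \ae mu, 0 <= u x.

End operators.

Section versions.
Context d (T : measurableType d) (R : realType).
Variable mu : {measure set T -> \bar R}.
Implicit Types h f e g : T -> \bar R.
Local Open Scope ereal_scope.

(* The library's 'd nu '/d mu requires nu to be finite, which the pushforward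
   of a sigma-finite measure need not be. *)
Definition is_RN_derivative (nu : set T -> \bar R) h : Prop :=
  [/\ measurable_fun setT h,
      \forall x \ae mu, 0 <= h x
    & forall A, measurable A -> nu A = \int[mu]_(x in A) h x].

(* e is a version of E(f | phi^-1(F)), for f nonnegative and measurable. *)
Definition is_cond_exp (phi : T -> T) f e : Prop :=
  [/\ measurable_fun setT (e : g_sigma_algebra_preimageType phi -> \bar R),
      \forall x \ae mu, 0 <= e x
    & forall A, g_sigma_algebra_preimage phi A ->
        \int[mu]_(x in A) e x = \int[mu]_(x in A) f x].

(* g is a version of e o phi^-1, where h is the Radon-Nikodym derivative of
   the pushforward of mu along phi. *)
Definition is_comp_inv (phi : T -> T) h e g : Prop :=
  [/\ measurable_fun setT g,
      g \o phi = e %[ae mu]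
    & \forall x \ae mu, h x = 0 -> g x = 0].

End versions.

(* Main.v *)
Require Import Defs.
From HB Require Import structures.
From mathcomp Require Import all_boot all_order all_algebra.
From mathcomp Require Import all_classical all_reals all_analysis.
From mathcomp Require Import measurable_realfun ess_sup_inf complex ring.

Set Implicit Arguments.
Unset Strict Implicit.
Unset Printing Implicit Defensive.

Import Order.TTheory GRing.Theory Num.Theory.
Import numFieldNormedType.Exports.

Local Open Scope classical_set_scope.
Local Open Scope ring_scope.

(** The isometry equation for f says that the integral of |f o phi|^2 u equals
    the integral of |f|^2 u.  The theorem then rests on one change of
    variables, [integral_comp_weight]:

      int (F o phi) u dmu = int F (h g) dmu   for every measurable F >= 0,

    that is, h g is the density of the image under phi of the measure u dmu.
    On an indicator function 1_A it follows from the definitions: replacing u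
    by E(u) = g o phi does not change the integral over phi^-1(A), and the
    image of mu under phi has density h, so that

      int_(phi^-1 A) u dmu = int_(phi^-1 A) (g o phi) dmu = int_A g h dmu

    ([integral_preimage_comp_inv]).  Both this last equality and the passage
    from sets to functions F are instances of an extension principle,
    [ae_ge0_integral_compM_transfer], proved by approximation with simple
    functions: if the image of w dmu under psi agrees with v dnu on sets, then
    the two agree on nonnegative functions.

    If u = h g a.e., taking F = |f|^2 gives the isometry.  Conversely, applying
    the isometry to the indicator function of a set A of finite measure gives

      int_A h g dmu = int_(phi^-1 A) u dmu = int_A u dmu,

    where the integrals are finite because u is essentially bounded and the
    composition operator preserves L^2 ([integrable_mul_Loo]); finiteness
    matters since the inner product sends a divergent integral to 0.  Varying A
    inside each set of a cover of the space by countably many sets of finite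
    measure yields u = h g a.e. *)

(** * Change of variables with weights *)

Lemma measurable_preimage d d' (X : measurableType d) (Y : measurableType d')
    (psi : X -> Y) (A : set Y) :
  measurable_fun setT psi -> measurable A -> measurable (psi @^-1` A).
Proof. by move=> mpsi mA; rewrite -[X in measurable X]setTI; exact: mpsi. Qed.

Section weighted_change_of_variables.
Local Open Scope ereal_scope.
Import HBNNSimple.

Section approximation.
Context d d' (X : measurableType d) (Y : measurableType d') (R : realType).
Variables (mu : {measure set X -> \bar R}) (psi : X -> Y) (w : X -> \bar R).
Hypotheses (mpsi : measurable_fun setT psi) (mw : measurable_fun setT w).
Hypothesis w0 : forall x, 0 <= w x.

(** The right-hand side depends on w, psi and mu only through the set function
    sending A to the integral of w over the preimage of A: this is what lets
    two weights be compared. *)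
Lemma integral_nnsfun_compM (f : {nnsfun Y >-> R}) :
  \int[mu]_x ((f (psi x))%:E * w x) =
  \sum_(k \in range f)
    (k%:E * \int[mu]_(x in psi @^-1` (f @^-1` [set k])) w x).
Proof.
have mind k : measurable_fun setT
    (fun x => (\1_(f @^-1` [set k]) (psi x))%:E : \bar R).
  apply/measurable_EFinP; apply: (measurableT_comp _ mpsi).
  exact: measurable_indic.
transitivity (\int[mu]_x \sum_(k \in range f)
    (k%:E * ((\1_(f @^-1` [set k]) (psi x))%:E * w x))).
  apply: eq_integral => x _.
  rewrite fimfunE -fsumEFin// ge0_mule_fsuml; last first.
    by move=> k; rewrite EFinM; exact: nnfun_muleindic_ge0.
  by apply: eq_fsbigr => k _; rewrite EFinM muleA.
rewrite ge0_integral_fsum//; last 2 first.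
- by move=> k; apply: emeasurable_funM => //; exact: emeasurable_funM.
- by move=> k x _; rewrite muleA mule_ge0//; exact: nnfun_muleindic_ge0.
apply: eq_fsbigr => k /[!inE] -[y _ <-].
rewrite ge0_integralZl ?lee_fin//; last 2 first.
- exact: emeasurable_funM.
- by move=> x _; rewrite mule_ge0// lee_fin.
congr (_ * _); rewrite [RHS]integral_mkcond.
by apply: eq_integral => x _; rewrite epatch_indic muleC.
Qed.

Lemma cvg_approx_integral_compM (F : Y -> \bar R) (mF : measurable_fun setT F) :
  (forall y, 0 <= F y) ->
  \int[mu]_x (F (psi x) * w x) =
  limn (fun n => \int[mu]_x ((nnsfun_approx measurableT mF n (psi x))%:E * w x)).
Proof.
move=> F0; rewrite -monotone_convergence//.
- apply: eq_integral => x _; apply/esym/cvg_lim => //.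
  have Fcvg : (nnsfun_approx measurableT mF n (psi x))%:E @[n --> \oo] -->
      F (psi x) by exact: cvg_nnsfun_approx.
  (* Multiplication is discontinuous at (0, +oo), so the points where one of
     the factors vanishes are treated apart; there the product is constantly
     0 along the approximation. *)
  have [Fx0|Fx0] := eqVneq (F (psi x)) 0.
    rewrite [X in X @ _ --> _](_ : _ = cst 0).
      by rewrite Fx0 mul0e; exact: cvg_cst.
    apply/funext => n /=.
    suff -> : nnsfun_approx measurableT mF n (psi x) = 0%R by rewrite mul0e.
    apply/eqP; rewrite eq_le -!lee_fin; apply/andP; split; last by rewrite lee_fin.
    by rewrite -[leRHS]/0 -Fx0 nnsfun_approxE; exact: le_approx.
  have [wx0|wx0] := eqVneq (w x) 0.
    rewrite wx0 mule0; under eq_fun do rewrite mule0.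
    exact: cvg_cst.
  apply: cvgeM => //; last exact: cvg_cst.
  by move: Fx0 wx0; case: (F _) => [r||]; case: (w x) => [s||].
- move=> n; apply: emeasurable_funM => //; apply/measurable_EFinP.
  by apply: (measurableT_comp _ mpsi).
- by move=> n x _; rewrite mule_ge0 ?lee_fin.
- move=> x _ m n mn; apply: lee_wpmul2r => //; rewrite lee_fin.
  exact/lefP/nd_nnsfun_approx.
Qed.

End approximation.

Section transfer.
Context d d' (X : measurableType d) (Y : measurableType d') (R : realType).
Variables (mu : {measure set X -> \bar R}) (nu : {measure set Y -> \bar R}).
Variable psi : X -> Y.
Hypothesis mpsi : measurable_fun setT psi.

Lemma ge0_integral_compM_transfer
    (w : X -> \bar R) (v F : Y -> \bar R) :
  measurable_fun setT w -> measurable_fun setT v ->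
  (forall x, 0 <= w x) -> (forall y, 0 <= v y) ->
  (forall A, measurable A ->
    \int[mu]_(x in psi @^-1` A) w x = \int[nu]_(y in A) v y) ->
  measurable_fun setT F -> (forall y, 0 <= F y) ->
  \int[mu]_x (F (psi x) * w x) = \int[nu]_y (F y * v y).
Proof.
move=> mw mv w0 v0 wv mF F0.
rewrite (cvg_approx_integral_compM mu mpsi mw w0 mF)//.
rewrite (cvg_approx_integral_compM nu (@measurable_id _ Y setT) mv v0 mF)//.
congr (limn _); apply/funext => n.
rewrite !integral_nnsfun_compM//; apply: eq_fsbigr => k _.
by rewrite wv.
Qed.

(** Radon-Nikodym derivatives and conditional expectations are nonnegative only
    almost everywhere; truncating the weights at 0 changes no integral. *)
Lemma ae_ge0_integral_compM_transfer
    (w : X -> \bar R) (v F : Y -> \bar R) :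
  measurable_fun setT w -> measurable_fun setT v ->
  (\forall x \ae mu, 0 <= w x) -> (\forall y \ae nu, 0 <= v y) ->
  (forall A, measurable A ->
    \int[mu]_(x in psi @^-1` A) w x = \int[nu]_(y in A) v y) ->
  measurable_fun setT F -> (forall y, 0 <= F y) ->
  \int[mu]_x (F (psi x) * w x) = \int[nu]_y (F y * v y).
Proof.
move=> mw mv w0 v0 wv mF F0.
pose w' x := maxe 0 (w x); pose v' y := maxe 0 (v y).
have mw' : measurable_fun setT w' by exact: measurable_maxe.
have mv' : measurable_fun setT v' by exact: measurable_maxe.
have ww' : \forall x \ae mu, w x = w' x.
  by apply: filterS w0 => x wx0; rewrite /w' max_r.
have vv' : \forall y \ae nu, v y = v' y.
  by apply: filterS v0 => y vy0; rewrite /v' max_r.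
have mFpsi : measurable_fun setT (F \o psi) by exact: measurableT_comp.
transitivity (\int[mu]_x (F (psi x) * w' x)).
  apply: ae_eq_integral => //; [exact: emeasurable_funM..|].
  by apply: filterS ww' => x ->.
transitivity (\int[nu]_y (F y * v' y)); last first.
  apply: ae_eq_integral => //; [exact: emeasurable_funM..|].
  by apply: filterS vv' => y ->.
apply: ge0_integral_compM_transfer => //.
- by move=> x; rewrite le_max lexx.
- by move=> y; rewrite le_max lexx.
- move=> A mA; transitivity (\int[mu]_(x in psi @^-1` A) w x).
    apply: ae_eq_integral; [exact: measurable_preimage|exact: measurable_funTS..|].
    by apply: filterS ww' => x ->.
  rewrite wv//; apply: ae_eq_integral => //; [exact: measurable_funTS..|].
  by apply: filterS vv' => y ->.
Qed.

End transfer.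

End weighted_change_of_variables.

(** * The density of the image of f dmu under phi *)

Section composition_weight.
Local Open Scope ereal_scope.
Context d (T : measurableType d) (R : realType).
Variables (mu : {measure set T -> \bar R}) (phi : T -> T).
Variables (f h e g : T -> \bar R).
Hypothesis mphi : measurable_fun setT phi.
Hypotheses (mf : measurable_fun setT f) (f0 : \forall x \ae mu, 0 <= f x).
Hypotheses (hh : is_RN_derivative mu (pushforward mu phi) h).
Hypotheses (he : is_cond_exp mu phi f e) (hg : is_comp_inv mu phi h e g).

Lemma measurable_cond_exp : measurable_fun setT e.
Proof.
case: he => me _ _ _ B mB; have [C mC <-] := me measurableT B mB.
by rewrite setTI; exact: measurable_preimage.
Qed.

(** Nonnegativity of e = g o phi only bounds g almost everywhere for the image
    measure h dmu, hence mu-a.e. where h does not vanish; elsewhere g is 0 by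
    normalization. *)
Lemma comp_inv_ge0 : \forall x \ae mu, 0 <= g x.
Proof.
have [mh h0 muh] := hh; have [_ e0 _] := he; have [mg gphi gh0] := hg.
pose N := g @^-1` `]-oo, 0[.
have mN : measurable N.
  by rewrite -[N]setTI; apply: mg => //; exact: emeasurable_itv.
have hN0 : \int[mu]_(x in N) h x = 0.
  rewrite -muh// /pushforward.
  apply/negligibleP; first exact: measurable_preimage.
  have : \forall x \ae mu, ~ (phi @^-1` N) x.
    apply: filterS2 gphi e0 => x gx ex.
    by rewrite /N /= in_itv/= -[g (phi x)]/((g \o phi) x) gx// ltNge ex.
  by case=> Z [mZ Z0 NZ]; exists Z; split => // x Nx; apply: NZ => /=; apply.
have : ae_eq mu N h (cst 0).
  apply/ae_eq_integral_abs => //; first exact: measurable_funTS.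
  rewrite -hN0; apply: ae_eq_integral => //.
  - by apply: measurableT_comp => //; exact: measurable_funTS.
  - exact: measurable_funTS.
  - by apply: filterS h0 => x hx _; rewrite gee0_abs.
move=> hN; apply: filterS2 hN gh0 => x hx gx.
rewrite leNgt; apply/negP => gx0; move: (gx0).
by rewrite gx ?ltxx// hx// /N /= in_itv.
Qed.

Lemma integral_preimage_comp_inv A : measurable A ->
  \int[mu]_(x in phi @^-1` A) f x = \int[mu]_(x in A) (h x * g x).
Proof.
move=> mA; have [mh h0 muh] := hh; have [me e0 ef] := he.
have [mg gphi gh0] := hg.
pose g' x := maxe 0 (g x).
have g'0 x : 0 <= g' x by rewrite le_max lexx.
have mg' : measurable_fun setT g' by exact: measurable_maxe.
have mg'phi : measurable_fun setT (g' \o phi) by exact: measurableT_comp.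
have mg'A : measurable_fun setT (g' \_ A).
  by apply/(measurable_restrictT _ _).1 => //; exact: measurable_funTS.
rewrite -ef; last by exists A => //; rewrite setTI.
transitivity (\int[mu]_(x in phi @^-1` A) (g' (phi x))).
  apply: ae_eq_integral; first exact: measurable_preimage.
  - exact/measurable_funTS/measurable_cond_exp.
  - exact: measurable_funTS.
  - apply: filterS2 gphi e0 => x gx ex _.
    by rewrite /g' -[g (phi x)]/((g \o phi) x) gx// max_r.
(* The weight 1 has h as its image density. *)
transitivity (\int[mu]_x ((g' \_ A) (phi x) * cst 1 x)).
  rewrite integral_mkcond; apply: eq_integral => x _.
  by rewrite mule1 !patchE.
rewrite (@ae_ge0_integral_compM_transfer _ _ _ _ _ mu mu phi mphi _ h)//; last 3 first.
- exact: aeW.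
- by move=> B mB; rewrite -muh// integral_cst ?mul1e//; exact: measurable_preimage.
- by move=> x; rewrite patchE; case: ifP.
rewrite [RHS]integral_mkcond; apply: ae_eq_integral => //.
- exact: emeasurable_funM.
- by apply/(measurable_restrictT _ _).1 => //; apply: measurable_funTS;
    exact: emeasurable_funM.
- apply: filterS comp_inv_ge0 => x gx _; rewrite !patchE.
  by case: ifP => _; rewrite ?mul0e// /g' max_r// muleC.
Qed.

Lemma integral_comp_weight (F : T -> \bar R) :
  measurable_fun setT F -> (forall x, 0 <= F x) ->
  \int[mu]_x (F (phi x) * f x) = \int[mu]_x (F x * (h x * g x)).
Proof.
move=> mF F0; have [mh h0 _] := hh; have [mg _ _] := hg.
apply: ae_ge0_integral_compM_transfer => //.
- exact: emeasurable_funM.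
- by apply: filterS2 h0 comp_inv_ge0 => x hx gx; exact: mule_ge0.
- exact: integral_preimage_comp_inv.
Qed.

End composition_weight.

(** * Seminorms as integrals of squared moduli *)

Section seminorm_integral.
Context d (T : measurableType d) (R : realType).
Variables (mu : {measure set T -> \bar R}).

Definition sqr_modulus (z : R[i]) : R :=
  (complex.Re z ^+ 2 + complex.Im z ^+ 2)%R.

Lemma sqr_modulus_ge0 z : (0 <= sqr_modulus z)%R.
Proof. by rewrite addr_ge0// sqr_ge0. Qed.

(** Real because the integrand is; the [fine] comes from the real-valued
    integral, which sends a divergent integral to 0. *)
Lemma inner_mul_op (u : T -> R) (f : T -> R[i]) :
  inner mu (mul_op u f) f =
  real_complex R (fine (\int[mu]_x ((sqr_modulus (f x))%:E * (u x)%:E))).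
Proof.
rewrite /inner /cintegral; congr Complex.
  rewrite /Rintegral; congr fine; apply: eq_integral => x _.
  by rewrite -EFinM /mul_op /sqr_modulus; case: (f x) => a b /=; congr EFin; ring.
rewrite /Rintegral (eq_integral (cst 0%E)) ?integral0// => x _.
by rewrite /mul_op; case: (f x) => a b /=; congr EFin; ring.
Qed.

Lemma measurable_sqr_modulus (f : T -> R[i]) : L2 mu f ->
  measurable_fun setT (fun x => (sqr_modulus (f x))%:E).
Proof.
case=> mre mim _; apply/measurable_EFinP.
by apply: measurable_funD; exact: measurable_funX.
Qed.

Lemma L2norm_lty (f : T -> R[i]) :
  (L2norm mu f < +oo)%E <-> (\int[mu]_x (sqr_modulus (f x))%:E < +oo)%E.
Proof.
have E : (\int[mu]_x (sqr_modulus (f x))%:E = L2norm mu f `^ 2)%E.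
  rewrite /L2norm poweR_Lnorm//; apply: eq_integral => x _ /=.
  rewrite powR_mulrn// real_normK ?num_real//; case: (f x) => a b /=.
  by rewrite sqr_sqrtr// addr_ge0 ?sqr_ge0.
rewrite E; split => [|/lty_poweRy]; last exact.
exact: poweR_lty.
Qed.

Lemma seminormE (u : T -> R) (f f' : T -> R[i]) :
  seminorm mu (mul_op u) f = seminorm mu (mul_op u) f' <->
  fine (\int[mu]_x ((sqr_modulus (f x))%:E * (u x)%:E)) =
  fine (\int[mu]_x ((sqr_modulus (f' x))%:E * (u x)%:E)).
Proof.
rewrite /seminorm !inner_mul_op; split => [|->//].
by move=> /(congr1 (fun z => z ^+ 2)); rewrite !sqrtCK => -[].
Qed.

(** With F the squared modulus of an L^2 function, this allows the [fine] in
    [seminormE] to be removed. *)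
Lemma integrable_mul_Loo (u : T -> R) (F : T -> R) : u \in Lfun mu +oo%E ->
  measurable_fun setT F -> (forall x, (0 <= F x)%R) ->
  (\int[mu]_x (F x)%:E < +oo)%E ->
  mu.-integrable setT (fun x => (F x)%:E * (u x)%:E)%E.
Proof.
move=> /andP[/[!inE]/= meu /= ufin] mF F0 intF.
have [M M0 uM] : exists2 M : R, (0 <= M)%R & \forall x \ae mu, (`|u x| <= M)%R.
  move: ufin; rewrite /finite_norm unlock /Lnorm; case: ifPn => [_|].
    move=> /(@ess_supr_bounded _ _ _ mu (Num.norm \o u)) [M uM].
    by exists `|M|%R => //; apply: filterS uM => x /le_trans; apply; exact: ler_norm.
  rewrite -leNgt measure_le0 => /eqP muT0 _; exists 0%R => //.
  by exists setT; split.
have mFu : measurable_fun setT (fun x => (F x)%:E * (u x)%:E)%E.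
  by apply: emeasurable_funM; exact/measurable_EFinP.
apply/integrableP; split => //.
apply: (@le_lt_trans _ _ (\int[mu]_x (M%:E * (F x)%:E))%E).
  apply: ae_ge0_le_integral => //.
  - exact: measurableT_comp.
  - by move=> x _; rewrite mule_ge0 ?lee_fin.
  - by apply: emeasurable_funM => //; exact/measurable_EFinP.
  - apply: filterS uM => x uxM _.
    by rewrite -EFinM abse_EFin lee_fin normrM ger0_norm// mulrC ler_wpM2r.
rewrite ge0_integralZl ?lee_fin//; last 2 first.
- exact/measurable_EFinP.
- by move=> x _; rewrite lee_fin.
by rewrite lte_mul_pinfty// lee_fin.
Qed.

End seminorm_integral.

(** * Complex indicator functions *)

Section indicator.
Context d (T : measurableType d) (R : realType).
Variables (mu : {measure set T -> \bar R}) (A : set T).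

Definition cindic (x : T) : R[i] := real_complex R (\1_A x).

Lemma sqr_modulus_cindic x : sqr_modulus (cindic x) = \1_A x.
Proof.
rewrite /sqr_modulus /= indicE; case: (_ \in _); last by rewrite !expr0n addr0.
by rewrite expr1n expr0n addr0.
Qed.

Lemma L2_cindic : measurable A -> (mu A < +oo)%E -> L2 mu cindic.
Proof.
move=> mA muA; split; [exact: measurable_indic|exact: measurable_cst|].
apply/L2norm_lty; under eq_integral do rewrite sqr_modulus_cindic.
by rewrite integral_indic// setIT.
Qed.

End indicator.

(** * The characterization of isometries *)

Theorem theorem2p5 (R : realType) (d : measure_display) (T : measurableType d)
  (mu : {sigma_finite_measure set T -> \bar R})
  (u : T -> R) (hu : positive_multiplier mu u)
  (phi : T -> T) (mphi : measurable_fun setT phi)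
  (phi_ns : pushforward mu phi `<< mu)
  (bphi : bounded_operator mu (comp_op phi))
  (h Eu g : T -> \bar R)
  (hh : is_RN_derivative mu (pushforward mu phi) h)
  (hEu : is_cond_exp mu phi (EFin \o u) Eu)
  (hg : is_comp_inv mu phi h Eu g) :
  A_isometry mu (mul_op u) (comp_op phi) <->
  \forall x \ae mu, (u x)%:E = (h x * g x)%E.
Proof.
have [uLoo u0] := hu; have [SL2 _ _ _] := bphi.
have [mh h0 _] := hh; have [mg _ _] := hg.
have meu : measurable_fun setT (EFin \o u).
  by apply/measurable_EFinP; move: uLoo => /andP[/[!inE]].
have transfer := integral_comp_weight mphi meu u0 hh hEu hg.
have mhg : measurable_fun setT (fun x => h x * g x)%E by exact: emeasurable_funM.
split => [iso|uhg f fL2]; last first.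
  apply/seminormE; congr fine.
  have mf := measurable_sqr_modulus fL2.
  have f0 x : (0 <= (sqr_modulus (f x))%:E)%E by rewrite lee_fin sqr_modulus_ge0.
  rewrite (transfer (fun x => (sqr_modulus (f x))%:E) mf f0).
  apply: ae_eq_integral => //; [exact: emeasurable_funM..|].
  by apply: filterS uhg => x ->.
have indic_int A : measurable A -> (mu A < +oo)%E ->
    mu.-integrable setT (fun x => (\1_A x)%:E * (u x)%:E)%E.
  move=> mA muA; apply: integrable_mul_Loo => //.
  by rewrite integral_indic// setIT.
have patchM A (v : T -> \bar R) :
    (\int[mu]_x ((\1_A x)%:E * v x) = \int[mu]_(x in A) v x)%E.
  rewrite [RHS]integral_mkcond.
  by apply: eq_integral => x _; rewrite epatch_indic muleC.
have finite_eq A : measurable A -> (mu A < +oo)%E ->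
    (\int[mu]_(x in A) (u x)%:E = \int[mu]_(x in A) (h x * g x))%E.
  move=> mA muA; have fL2 := L2_cindic mA muA.
  have [_ _ /L2norm_lty phiA] := SL2 _ fL2.
  have /seminormE := iso _ fL2.
  have sqrE x : sqr_modulus (cindic R A x) = \1_A x by exact: sqr_modulus_cindic.
  under eq_integral do rewrite /comp_op /= sqrE.
  under [in RHS]eq_integral do rewrite sqrE.
  have phi_int : mu.-integrable setT (fun x => (\1_A (phi x))%:E * (u x)%:E)%E.
    apply: integrable_mul_Loo => //.
      by apply: (measurableT_comp _ mphi); exact: measurable_indic.
    by under eq_integral do rewrite -sqrE.
  move=> fineE; move: (congr1 EFin fineE).
  rewrite !fineK ?integrable_fin_num//; last exact: indic_int.
  rewrite (transfer (fun x => (\1_A x)%:E))//; last exact/measurable_EFinP.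
  by rewrite !patchM.
have [F TF mF] := sigma_finiteT mu.
have uhgF n : \forall x \ae mu, F n x -> (u x)%:E = (h x * g x)%E.
  have [mFn muFn] := mF n.
  apply: integral_ae_eq => //; last 2 first.
  - exact: measurable_funTS.
  - move=> E EF mE; apply: finite_eq => //.
    by apply: le_lt_trans muFn; apply: le_measure; rewrite ?inE.
  apply/integrableP; split; first exact: measurable_funTS.
  rewrite -patchM; have /integrableP[_] := indic_int _ mFn muFn.
  by under eq_integral do rewrite abseM gee0_abs ?lee_fin//.
have /ae_foralln := uhgF; apply: filterS => x ux.
have [n _ Fnx] : (\bigcup_n F n) x by rewrite -TF.
exact: ux Fnx.
Qed.
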